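(* Let $m\ge 2$ be an integer and $e=3^h-1$, where $1\le h\le m-1$. The ternary cyclic code $\mathcal{C}_{(1,e)}$ has parameters $[3^m-1,\,3^m-1-2m,\,4]$ if and only if (A) $\gcd(h,m)=1$; and (B) $\gcd(3^h-2,3^m-1)=1$.
   Context: Let $q=3^m$, $n=q-1$, $\alpha$ a generator of $\mathrm{GF}(q)^*$, and $m_a(x)$ the minimal polynomial of $a\in\mathrm{GF}(q)$ over $\mathrm{GF}(3)$. $C_j$ denotes the $3$-cyclotomic coset modulo $n$ containing $j$, i.e. $\{j,3j,3^2j,\dots\}$ mod $n$. For $1<e<q-1$ with $e\notin C_1$, $\mathcal{C}_{(1,e)}$ is the cyclic code of length $n$ over $\mathrm{GF}(3)$ with generator polynomial $m_\alpha(x)m_{\alpha^e}(x)$. *)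

(* Defs.v *)
From HB Require Import structures.
From mathcomp Require Import all_boot all_order all_algebra all_field.
Set Implicit Arguments. Unset Strict Implicit. Unset Printing Implicit Defensive.
Import GRing.Theory.
Local Open Scope ring_scope.

Notation F3 := 'F_3.

Definition word_poly (n : nat) (c : 'rV[F3]_n) : {poly F3} :=
  Poly [seq c 0 i | i <- enum 'I_n].

Definition wt (n : nat) (c : 'rV[F3]_n) : nat := #|[set i : 'I_n | c 0 i != 0]|.

(* The cyclic code of length n over GF(3) with generator polynomial
   m_a(x) m_{a^e}(x), where m_b = minPoly 1 b is the (monic) minimal polynomial
   of b over the prime field GF(3) (= the subfield 1%VS of L). A word is a
   codeword iff its polynomial is divisible by the generator polynomial. *)
Definition cyclic_code_1e (L : fieldExtType F3) (n e : nat) (a : L)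
  : {set 'rV[F3]_n} :=
  [set c | (minPoly 1%VS a * minPoly 1%VS (a ^+ e))
             %| map_poly (in_alg L) (word_poly c)].

Definition has_params (n : nat) (C : {set 'rV[F3]_n}) (k d : nat) : Prop :=
  [/\ #|C| = (3 ^ k)%N,
      exists2 c, c \in C & (c != 0) && (wt c == d)
    & forall c, c \in C -> c != 0 -> (d <= wt c)%N].

(* Main.v *)
Require Import Defs.
From HB Require Import structures.
From mathcomp Require Import all_boot all_order all_algebra all_field.
From mathcomp Require Import zify ring.

(* Write Q = 3^h, e = Q - 1 and q = 3^m. Since x |-> x^Q is additive, for X + Y != 0
   X^e + Y^e + (X+Y)^e vanishes iff X^e = Y^e or X = Y, and
   X^e + Y^e - (X+Y)^e vanishes iff X^e Y + Y^e X = 0, i.e. v = -X/Y has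
   v^(Q-2) = 1. As e is even, absorbing signs into the field elements reduces a
   codeword of weight 3 to one of these two equations: a word with equal signs
   gives a fixed point X/Y of x |-> x^Q outside GF(3), which exists iff
   gcd(h,m) > 1, and a word with mixed signs gives v != 1 with v^(Q-2) = 1, which
   exists iff gcd(Q-2,q-1) > 1. Weights 1 and 2 never occur, a sphere-packing
   count yields a word of weight at most 4, and the dimension follows from both
   minimal polynomials having degree m. *)

Set Implicit Arguments. Unset Strict Implicit. Unset Printing Implicit Defensive.
Import GRing.Theory VectorInternalTheory.
Local Open Scope ring_scope.

(** * Signs and powers in extensions of GF(3) *)

Lemma F3_neq0 (a : F3) : a != 0 -> a = 1 \/ a = -1.
Proof.
by case: a => [[|[|[|k]]] lt_k] // _; [left | right]; apply: val_inj.
Qed.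

Lemma pchar_F3ext (L : fieldExtType F3) : 3%N \in [pchar L].
Proof. by rewrite pchar_lalg pchar_Fp. Qed.

Lemma F3ext_exprD (L : fieldExtType F3) (x y : L) k :
  (x + y) ^+ (3 ^ k) = x ^+ (3 ^ k) + y ^+ (3 ^ k).
Proof.
apply: exprDn_pchar; rewrite pnatX; apply/orP; left.
by rewrite pnatE // pchar_F3ext.
Qed.

Lemma F3ext_three (L : fieldExtType F3) : 3%:R = 0 :> L.
Proof. by apply/eqP; case/andP: (pchar_F3ext L). Qed.

Lemma F3ext_expf (L : fieldExtType F3) (m : nat) (x : L) :
  \dim {:L} = m -> x ^+ (3 ^ m) = x.
Proof.
by move=> <-; have := memvf x; rewrite Fermat's_little_theorem card_Fp // => /eqP.
Qed.

Lemma expr_iter_fixed (R : nzRingType) (x : R) q k : x ^+ q = x -> x ^+ (q ^ k) = x.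
Proof. by move=> xq; elim: k => [|k IHk]; rewrite ?expr1 // expnS exprM xq. Qed.

(** Bezout gives [u * h = v * m + 1], so the power [q ^ (u * h)], which fixes [x], acts on [x] as
    the power [q]. *)
Lemma expr_coprime_fixed (R : nzRingType) (x : R) q h m :
  (0 < h)%N -> coprime h m -> x ^+ (q ^ h) = x -> x ^+ (q ^ m) = x -> x ^+ q = x.
Proof.
move=> h_gt0 /eqP gcd1; case: (egcdnP m h_gt0) => u v + _; rewrite gcd1 => eq_uv xh xm.
have := expr_iter_fixed u xh.
by rewrite -expnM (mulnC h) eq_uv expnD expn1 (mulnC v) expnM exprM (expr_iter_fixed v xm).
Qed.

Lemma expr_coprime_eq1 (R : nzRingType) (x : R) a b :
  (0 < a)%N -> coprime a b -> x ^+ a = 1 -> x ^+ b = 1 -> x = 1.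
Proof.
move=> a_gt0 /eqP gcd1; case: (egcdnP b a_gt0) => u v + _; rewrite gcd1 => eq_uv xa xb.
have: x ^+ (u * a) = 1 by rewrite mulnC exprM xa expr1n.
by rewrite eq_uv exprD mulnC exprM xb expr1n mul1r.
Qed.

(** * The equations [X^e + Y^e + (X+Y)^e = 0] and [X^e + Y^e = (X+Y)^e] *)

Section SumIdentities.
Variables (L : fieldExtType F3) (h : nat).
Local Notation e := (3 ^ h - 1)%N.

Lemma expr_pred_sum (X Y : L) :
  (X + Y) ^+ e * (X + Y) = X ^+ e * X + Y ^+ e * Y.
Proof.
have e1 : e.+1 = (3 ^ h)%N by rewrite subn1 prednK ?expn_gt0.
by rewrite -!exprSr e1 F3ext_exprD.
Qed.

Lemma expr_predN (X : L) : (- X) ^+ e = X ^+ e.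
Proof.
rewrite exprNn -signr_odd oddB ?expn_gt0 // oddX orbT /= expr0.
by rewrite mul1r.
Qed.

(** After expansion the two sides differ by three times [X^e X + Y^e Y], which is zero in
    characteristic 3. *)
Lemma sum_same_sign (X Y : L) :
  (X ^+ e + Y ^+ e + (X + Y) ^+ e) * (X + Y) = (X ^+ e - Y ^+ e) * (Y - X).
Proof.
rewrite mulrDl expr_pred_sum; apply/eqP; rewrite -subr_eq0; apply/eqP.
transitivity (3%:R * (X ^+ e * X + Y ^+ e * Y)); last by rewrite F3ext_three mul0r.
by ring.
Qed.

Lemma sum_mixed_sign (X Y : L) :
  (X ^+ e + Y ^+ e - (X + Y) ^+ e) * (X + Y) = X ^+ e * Y + Y ^+ e * X.
Proof. by rewrite mulrBl expr_pred_sum; ring. Qed.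

(** Otherwise [X / Y] is fixed by the powers [3 ^ h] and [3 ^ m], hence by cubing, so it is 1 or -1;
    the first contradicts [X != Y], the second [Z != 0]. *)
Lemma same_sign_neq0 m (X Y Z : L) :
  (0 < h)%N -> \dim {:L} = m -> coprime h m ->
  X != 0 -> Y != 0 -> Z != 0 -> X + Y + Z = 0 -> X != Y ->
  X ^+ e + Y ^+ e + Z ^+ e != 0.
Proof.
move=> h_gt0 dimL co_hm X0 Y0 Z0 /eqP; rewrite addrC addr_eq0 => /eqP defZ neqXY.
rewrite defZ expr_predN; apply/eqP => sum0.
have := sum_same_sign X Y; rewrite sum0 mul0r => /esym/eqP; rewrite mulf_eq0 !subr_eq0.
rewrite [Y == X]eq_sym (negPf neqXY) orbF => /eqP eqXY.
have w0 : X / Y != 0 by rewrite mulf_neq0 ?invr_eq0.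
have we : (X / Y) ^+ e = 1 by rewrite expr_div_n eqXY divff ?expf_neq0.
have w3 : (X / Y) ^+ 3 = X / Y.
  apply: expr_coprime_fixed co_hm _ (F3ext_expf _ dimL) => //.
  by rewrite -[(3 ^ h)%N]prednK ?expn_gt0 // -subn1 exprSr we mul1r.
have /eqP : (X / Y) ^+ 2 = 1 by apply: (mulIf w0); rewrite -exprSr w3 mul1r.
rewrite sqrf_eq1 => /orP[] /eqP eqw.
  by case/eqP: neqXY; rewrite -[X](divfK Y0) eqw mul1r.
by case/eqP: Z0; rewrite defZ -[X](divfK Y0) eqw mulN1r addNr oppr0.
Qed.

(** Otherwise the order of [v = - (X / Y)] divides both [3 ^ h - 2] and [3 ^ m - 1], so [v = 1],
    that is [X + Y = 0], against [Z != 0]. *)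
Lemma mixed_sign_neq m (X Y Z : L) :
  (0 < h)%N -> \dim {:L} = m -> coprime (3 ^ h - 2) (3 ^ m - 1) ->
  X != 0 -> Y != 0 -> Z != 0 -> X + Y + Z = 0 ->
  X ^+ e + Y ^+ e != Z ^+ e.
Proof.
move=> h_gt0 dimL co_B X0 Y0 Z0 /eqP; rewrite addrC addr_eq0 => /eqP defZ.
rewrite defZ expr_predN -subr_eq0; apply/eqP => sum0.
have := sum_mixed_sign X Y; rewrite sum0 mul0r => /esym/eqP; rewrite addr_eq0 => /eqP eqXY.
pose v := - (X / Y).
have v0 : v != 0 by rewrite oppr_eq0 mulf_neq0 ?invr_eq0.
have ve : v ^+ e = v.
  rewrite expr_predN expr_div_n; apply: (mulIf (mulf_neq0 (expf_neq0 e Y0) Y0)).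
  rewrite mulrA divfK ?expf_neq0 // eqXY.
  by rewrite [_ ^+ e * Y]mulrC /v mulNr mulrA divfK // mulrC.
(* Keeps the truncated subtraction [3 ^ h - 2] positive. *)
have Q_ge3 : (3 <= 3 ^ h)%N by apply: (@leq_pexp2l 3 1).
have v1 : v = 1.
  apply: expr_coprime_eq1 co_B _ _; first by rewrite subn_gt0.
    apply: (mulIf v0); rewrite -exprSr mul1r -[RHS]ve.
    by congr (_ ^+ _); lia.
  apply: (mulIf v0); rewrite -exprSr mul1r -[RHS](F3ext_expf _ dimL).
  by congr (_ ^+ _); have := expn_gt0 3 m; lia.
case/eqP: Z0; rewrite defZ -[X](divfK Y0) -[X / Y]opprK -/v v1.
by rewrite mulN1r addNr oppr0.
Qed.

(** The witness generates the multiplicative group of the subfield with [3 ^ g] elements,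
    [g = gcdn h m]. Its order is at least 8, so it is neither 1 nor -1, and [w ^+ e = 1] because [g]
    divides [h]. *)
Lemma exists_same_sign m (alpha : L) :
  (0 < h)%N -> (0 < m)%N -> (3 ^ m - 1)%N.-primitive_root alpha -> ~~ coprime h m ->
  exists w : L, [/\ w != 0, w + 1 != 0, w != 1 & w ^+ e + 1 + (w + 1) ^+ e = 0].
Proof.
move=> h_gt0 m_gt0 prim_a; set g := gcdn h m => nco.
have g_gt1 : (1 < g)%N by rewrite ltn_neqAle eq_sym nco gcdn_gt0 h_gt0.
have Q_ge9 : (3 ^ 2 <= 3 ^ g)%N by rewrite leq_pexp2l.
have dv : (3 ^ g - 1 %| 3 ^ m - 1)%N.
  by rewrite !subn1 -(divnK (dvdn_gcdr h m)) mulnC expnM dvdn_pred_predX.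
have prim_w := dvdn_prim_root prim_a dv; set w := alpha ^+ _ in prim_w.
have w1 : w ^+ (3 ^ g) = w.
  by rewrite -[(3 ^ g)%N]prednK ?expn_gt0 // -subn1 exprSr (prim_expr_order prim_w) mul1r.
have w0 : w != 0.
  apply/eqP => w0; have := prim_expr_order prim_w.
  by rewrite w0 expr0n; case: eqP => [|_ /esym/eqP]; [lia | rewrite oner_eq0].
have w2 : w ^+ 2 != 1.
  by rewrite -(prim_order_dvd prim_w); apply/negP => /dvdn_leq; lia.
have wh : w ^+ e = 1.
  apply: (mulIf w0); rewrite -exprSr mul1r subn1 prednK ?expn_gt0 //.
  by rewrite -(divnK (dvdn_gcdl h m)) mulnC expnM (expr_iter_fixed _ w1).
move: w2; rewrite sqrf_eq1 negb_or -addr_eq0 => /andP[wn1 wn2].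
exists w; split=> //; apply: (mulIf wn2).
by have := sum_same_sign w 1; rewrite expr1n wh subrr !mul0r.
Qed.

(** The witness is [- v], where [v] is a power of [alpha] whose order is the gcd of [3 ^ h - 2] and
    [3 ^ m - 1]. *)
Lemma exists_mixed_sign m (alpha : L) :
  (0 < h)%N -> (0 < m)%N -> (3 ^ m - 1)%N.-primitive_root alpha ->
  ~~ coprime (3 ^ h - 2) (3 ^ m - 1) ->
  exists w : L, [/\ w != 0, w + 1 != 0, w != 1 & w ^+ e + 1 = (w + 1) ^+ e].
Proof.
move=> h_gt0 m_gt0 prim_a; set d := gcdn (3 ^ h - 2) (3 ^ m - 1) => nco.
have Q_ge3 : (3 <= 3 ^ h)%N by apply: (@leq_pexp2l 3 1).
have d_gt1 : (1 < d)%N by rewrite ltn_neqAle eq_sym nco gcdn_gt0 subn_gt0 Q_ge3.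
have prim_v := dvdn_prim_root prim_a (dvdn_gcdr (3 ^ h - 2) _).
rewrite -/d in prim_v; set v := alpha ^+ _ in prim_v.
have v0 : v != 0.
  apply/eqP => v0; have := prim_expr_order prim_v.
  by rewrite v0 expr0n; case: eqP => [|_ /esym/eqP]; [lia | rewrite oner_eq0].
have v1 : v != 1.
  by rewrite -[v]expr1 -(prim_order_dvd prim_v) dvdn1; lia.
have ve : v ^+ e = v.
  have -> : e = (3 ^ h - 2).+1 by lia.
  have /eqP vd : v ^+ (3 ^ h - 2) == 1 by rewrite -(prim_order_dvd prim_v) dvdn_gcdl.
  by rewrite exprSr vd mul1r.
have two0 : 2%:R != 0 :> L.
  apply/eqP => two0; have : 2%:R + 1%:R = 0 :> L by rewrite -natrD F3ext_three.
  by move/eqP; rewrite two0 add0r oner_eq0.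
have wn1 : - v + 1 != 0 by rewrite addrC subr_eq0 eq_sym.
have mixed : (- v) ^+ e + 1 = (- v + 1) ^+ e.
  apply/eqP; rewrite -subr_eq0; apply/eqP; apply: (mulIf wn1).
  have := sum_mixed_sign (- v) 1.
  by rewrite expr1n expr_predN ve mulr1 mul1r subrr mul0r.
exists (- v); split=> //; first by rewrite oppr_eq0.
(* At [w = 1] the equation reads [2 = 2^e], that is [-1 = (-1)^e], which fails since [e] is even. *)
apply/eqP => w1; move: mixed; rewrite w1 expr1n -mulr2n => /esym/eqP.
have -> : 1 *+ 2 = -1 :> L.
  by apply/eqP; rewrite -addr_eq0 -mulrSr F3ext_three.
rewrite expr_predN expr1n => /eqP eq1.
by case/eqP: two0; rewrite mulr2n {1}eq1 addNr.
Qed.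

End SumIdentities.

(** * Minimal polynomials over GF(3) and words divisible by a fixed polynomial *)

Lemma minPoly_F3P (L : fieldExtType F3) (x : L) :
  exists p : {poly F3}, minPoly 1%VS x = map_poly (in_alg L) p.
Proof. exact/polyOver1P/minPolyOver. Qed.

(** If [d] is the degree of [x], then [x] lies in a field of [3 ^ d] elements, so [x ^+ (3 ^ d) = x]
    and [m <= d]; conversely [d] is at most the dimension of [L]. *)
Lemma size_minPoly1 (L : fieldExtType F3) m (x : L) :
  \dim {:L} = m -> (forall d, (0 < d)%N -> x ^+ (3 ^ d) = x -> (m <= d)%N) ->
  size (minPoly 1%VS x) = m.+1.
Proof.
move=> dimL deg_min; rewrite size_minPoly; congr _.+1.
have deg_dim : adjoin_degree 1%VS x = \dim <<1; x>>.
  by have := dim_Fadjoin 1%AS x; rewrite dimv1 muln1.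
have x_in := memv_adjoin 1%AS x.
rewrite Fermat's_little_theorem card_Fp // -deg_dim in x_in.
apply/eqP; rewrite eqn_leq deg_min ?(eqP x_in) // andbT.
by rewrite deg_dim -dimL dimvS ?subvf.
Qed.

(** Cubing fixes the coefficients of [p], so it maps roots to roots. *)
Lemma root_F3_Frobenius (L : fieldExtType F3) (p : {poly F3}) (x : L) k :
  root (map_poly (in_alg L) p) x -> root (map_poly (in_alg L) p) (x ^+ (3 ^ k)).
Proof.
move=> px; elim: k => [|k IHk]; first by rewrite expr1.
rewrite expnSr exprM -(pFrobenius_autE (pchar_F3ext L)).
have -> : map_poly (in_alg L) p =
    map_poly (pFrobenius_aut (pchar_F3ext L)) (map_poly (in_alg L) p).
  rewrite -map_poly_comp; apply: eq_map_poly => a /=.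
  by rewrite pFrobenius_autE exprZn expr1n -{1}(expf_card a) card_Fp.
by rewrite fmorph_root.
Qed.

(** Multiplication by [g] is a bijection from the words of length [n - d] onto the words counted. *)
Lemma card_dvdp_words (F : finFieldType) n d (g : {poly F}) :
  size g = d.+1 -> (d <= n)%N ->
  #|[set c : 'rV[F]_n | g %| rVpoly c]| = (#|F| ^ (n - d))%N.
Proof.
move=> sz_g le_dn; have g0 : g != 0 by rewrite -size_poly_eq0 sz_g.
have sz_mul (q : 'rV[F]_(n - d)) : (size (g * rVpoly q)%R <= n)%N.
  have [-> | q0] := eqVneq (rVpoly q) 0; first by rewrite mulr0 size_poly0.
  by rewrite size_mul // sz_g /= -leq_subRL // size_poly.
have <- : #|[set: 'rV[F]_(n - d)]| = (#|F| ^ (n - d))%N by rewrite cardsT card_mx mul1n.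
have inj : injective (fun q : 'rV[F]_(n - d) => poly_rV (g * rVpoly q) : 'rV[F]_n).
  move=> q r /(congr1 rVpoly); rewrite !poly_rV_K // => /(mulfI g0).
  exact: (can_inj rVpolyK).
rewrite -(card_imset _ inj); apply: eq_card => c; rewrite inE.
apply/idP/imsetP => [|[q _ ->]]; last by rewrite poly_rV_K // dvdp_mulr.
rewrite dvdp_eq => /eqP def_c; exists (poly_rV (rVpoly c %/ g)) => //.
rewrite poly_rV_K; first by rewrite mulrC -def_c rVpolyK.
by rewrite size_divp // sz_g leq_sub2r // size_poly.
Qed.

Lemma word_polyE n (c : 'rV[F3]_n) : word_poly c = rVpoly c.
Proof.
apply/polyP => k; rewrite coef_Poly coef_rVpoly.
case: insubP => [i _ <- | ]; last first.
  by rewrite -leqNgt => le_nk; rewrite nth_default // size_map size_enum_ord.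
by rewrite (nth_map i) ?size_enum_ord //= nth_ord_enum.
Qed.

(** * Incompatibility of the two parity checks on two or three terms *)

(** Opposite coefficients would force [x = y]. Equal ones force [y = - x]; as [e] is even, the sum
    is then twice a nonzero element. *)
Lemma two_terms_neq0 (L : fieldExtType F3) (h : nat) (a b : F3) (x y : L) :
  a != 0 -> b != 0 -> x != 0 -> x != y ->
  a *: x + b *: y = 0 -> a *: x ^+ (3 ^ h - 1) + b *: y ^+ (3 ^ h - 1) != 0.
Proof.
move=> a0 b0 x0 neq_xy /eqP.
have double (c : F3) (u : L) : c != 0 -> u != 0 -> c *: u + c *: u != 0.
  move=> c0 u0; rewrite -scalerDl scaler_eq0 negb_or u0 andbT.
  by case: (F3_neq0 c0) => ->.
have [/eqP eq_ab | neq_ab] := boolP (a == b).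
  rewrite -eq_ab -scalerDr scaler_eq0 (negPf a0) /= addrC addr_eq0 => /eqP ->.
  by rewrite expr_predN double ?expf_neq0.
have -> : b = - a.
  by case: (F3_neq0 a0) (F3_neq0 b0) neq_ab => -> [] ->; rewrite ?eqxx ?opprK.
by rewrite scaleNr subr_eq0 (can_eq (scalerK _)) // (negPf neq_xy).
Qed.

(** A global sign change makes [a = 1]. Of the four sign patterns left, the constant one is
    [same_sign_neq0]; the others become [u + v - w = 0] after reordering and possibly negating, and
    [mixed_sign_neq] applies with [Z = - w]. *)
Lemma three_terms_neq0 (L : fieldExtType F3) (h m : nat) (a b c : F3) (x y z : L) :
  (0 < h)%N -> \dim {:L} = m -> coprime h m -> coprime (3 ^ h - 2) (3 ^ m - 1) ->
  a != 0 -> b != 0 -> c != 0 -> x != 0 -> y != 0 -> z != 0 -> x != y ->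
  a *: x + b *: y + c *: z = 0 ->
  a *: x ^+ (3 ^ h - 1) + b *: y ^+ (3 ^ h - 1) + c *: z ^+ (3 ^ h - 1) != 0.
Proof.
move=> h_gt0 dimL coA coB a0 b0 c0 x0 y0 z0 neq_xy.
have mixed (u v w : L) : u != 0 -> v != 0 -> w != 0 -> u + v - w = 0 ->
    u ^+ (3 ^ h - 1) + v ^+ (3 ^ h - 1) - w ^+ (3 ^ h - 1) != 0.
  move=> u0 v0 w0 uvw; rewrite subr_eq0 -(expr_predN _ w).
  by apply: (mixed_sign_neq h_gt0 dimL coB _ _ _ uvw); rewrite ?oppr_eq0.
have pos (d f : F3) : d != 0 -> f != 0 -> x + d *: y + f *: z = 0 ->
    x ^+ (3 ^ h - 1) + d *: y ^+ (3 ^ h - 1) + f *: z ^+ (3 ^ h - 1) != 0.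
  move=> /F3_neq0[] -> /F3_neq0[] ->; rewrite !(scale1r, scaleN1r) => sum0.
  - exact: (same_sign_neq0 h_gt0 dimL coA _ _ _ sum0 neq_xy).
  - exact: mixed.
  - by rewrite addrAC; apply: mixed => //; rewrite addrAC.
  rewrite -oppr_eq0 !opprD !opprK -addrA addrC; apply: mixed => //.
  by apply/eqP; rewrite -oppr_eq0 !opprD opprK addrC addrA sum0.
have [-> | ->] := F3_neq0 a0; first by rewrite !scale1r; apply: pos.
move=> sum0; rewrite -oppr_eq0 !opprD -!scaleNr opprK scale1r.
apply: pos; rewrite ?oppr_eq0 //.
by apply/eqP; rewrite -oppr_eq0 !opprD -!scaleNr !opprK -scaleN1r sum0.
Qed.

(** * Syndromes *)

(** The value at [b] of the word's polynomial ([horner_word_poly]), in a form whose linearity and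
    restriction to the support are direct. *)
Definition syndrome (L : fieldExtType F3) n (b : L) (c : 'rV[F3]_n) : L :=
  \sum_(i < n) c 0 i *: b ^+ i.

Lemma syndrome_is_linear (L : fieldExtType F3) n (b : L) :
  linear (@syndrome L n b).
Proof.
move=> a u v; rewrite /syndrome scaler_sumr -big_split; apply: eq_bigr => i _ /=.
by rewrite !mxE scalerDl scalerA.
Qed.

HB.instance Definition _ (L : fieldExtType F3) n (b : L) :=
  GRing.isLinear.Build F3 'rV[F3]_n L *:%R (@syndrome L n b) (syndrome_is_linear b).

Lemma syndrome_delta (L : fieldExtType F3) n (b : L) (i : 'I_n) :
  syndrome b (delta_mx 0 i) = b ^+ i.
Proof.
rewrite /syndrome (bigD1 i) //= mxE !eqxx scale1r big1 ?addr0 // => j neq_ji.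
by rewrite mxE (negPf neq_ji) andbF scale0r.
Qed.

(** The support is a list here, so that a case analysis on its length yields explicit sums. *)
Lemma syndrome_support (L : fieldExtType F3) n (b : L) (c : 'rV[F3]_n) :
  syndrome b c = \sum_(i <- enum [set i | c 0 i != 0]) c 0 i *: b ^+ i.
Proof.
rewrite big_enum /= /syndrome (bigID (mem [set i | c 0 i != 0])) /=.
rewrite [X in _ + X]big1 ?addr0 // => i; rewrite inE negbK => /eqP ->.
by rewrite scale0r.
Qed.

Lemma horner_word_poly (L : fieldExtType F3) n (b : L) (c : 'rV[F3]_n) :
  (map_poly (in_alg L) (word_poly c)).[b] = syndrome b c.
Proof.
rewrite word_polyE {1}(row_sum_delta c) !raddf_sum horner_sum; apply: eq_bigr => i _ /=.
by rewrite linearZ /= rVpoly_delta map_polyZ map_polyXn hornerZ hornerXn mulr_algl.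
Qed.

Lemma minPoly_dvdp_root (L : fieldExtType F3) (x : L) (p : {poly F3}) :
  (minPoly 1%VS x %| map_poly (in_alg L) p) = root (map_poly (in_alg L) p) x.
Proof.
apply/idP/idP => [/dvdpP[q ->]|]; first by rewrite rootM (root_minPoly 1%AS) orbT.
by apply: (minPoly_dvdp (K := 1%AS)); apply/polyOver1P; exists p.
Qed.

(** * Weights, and the signed two-position words used for counting *)

Lemma wtB n (c d : 'rV[F3]_n) : (wt (c - d)%R <= wt c + wt d)%N.
Proof.
apply: leq_trans (leq_card_setU _ _); apply/subset_leq_card/subsetP => i.
rewrite !inE !mxE -negb_and; apply: contra => /andP[/eqP -> /eqP ->].
by rewrite subr0.
Qed.

Lemma wtD n (c d : 'rV[F3]_n) : (wt (c + d)%R <= wt c + wt d)%N.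
Proof.
apply: leq_trans (leq_card_setU _ _); apply/subset_leq_card/subsetP => i.
rewrite !inE !mxE -negb_and; apply: contra => /andP[/eqP -> /eqP ->].
by rewrite addr0.
Qed.

Lemma wt_scale_delta n (a : F3) (i : 'I_n) : (wt (a *: delta_mx 0 i)%R <= 1)%N.
Proof.
apply: leq_trans (eq_leq (cards1 i)); apply/subset_leq_card/subsetP => j.
rewrite !inE !mxE.
by apply: contraR => /negPf ->; rewrite andbF mulr0.
Qed.

Definition pair_word n (p : ('I_n * 'I_n) * (bool * bool)) : 'rV[F3]_n :=
  (-1) ^+ p.2.1 *: delta_mx 0 p.1.1 + (-1) ^+ p.2.2 *: delta_mx 0 p.1.2.

Lemma wt_pair_word n p : (wt (@pair_word n p) <= 2)%N.
Proof.
apply: leq_trans (wtD _ _) _.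
exact: leq_add (wt_scale_delta _ _) (wt_scale_delta _ _).
Qed.

(** The nonzero entries determine the two positions up to order, which [i < j] fixes; the entries
    there then give the signs. *)
Lemma pair_word_inj n :
  {in setX [set ij : 'I_n * 'I_n | (ij.1 < ij.2)%N] setT &, injective (@pair_word n)}.
Proof.
move=> [[i j] [s t]] [[i' j'] [s' t']]; rewrite !inE /= !andbT => lt_ij lt_ij' eq_w.
have entry (k : 'I_n) := congr1 (fun u : 'rV[F3]_n => u 0 k) eq_w.
have sgn0 (b : bool) : (-1) ^+ b != 0 :> F3 by case: b.
have sgn_inj (b c : bool) : (-1) ^+ b = (-1) ^+ c :> F3 -> b = c by case: b; case: c.
rewrite /pair_word /= in entry.
have nij : (i == j) = false by apply/negbTE/eqP => eq_ij; rewrite eq_ij ltnn in lt_ij.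
have in_i : (i == i') || (i == j').
  apply/negPn; rewrite negb_or; apply/negP => /andP[/negPf n1 /negPf n2].
  have := entry i; rewrite !mxE !eqxx n1 n2 nij /= !(mulr0, mulr1, addr0) => /eqP.
  by rewrite (negPf (sgn0 _)).
have in_j : (j == i') || (j == j').
  apply/negPn; rewrite negb_or; apply/negP => /andP[/negPf n1 /negPf n2].
  have := entry j; rewrite !mxE !eqxx n1 n2 [j == i]eq_sym nij /=.
  rewrite !(mulr0, mulr1, add0r, addr0) => /eqP.
  by rewrite (negPf (sgn0 _)).
have [eq_i eq_j] : i = i' /\ j = j'.
  case/orP: in_i => /eqP eq_i; case/orP: in_j => /eqP eq_j.
  - by rewrite eq_i eq_j eqxx in nij.
  - by split.
  - by rewrite eq_i eq_j in lt_ij; have := ltn_trans lt_ij lt_ij'; rewrite ltnn.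
  - by rewrite eq_i eq_j eqxx in nij.
subst i' j'; have := entry i; rewrite !mxE !eqxx nij /= !(mulr0, mulr1, addr0) => /sgn_inj ->.
have := entry j; rewrite !mxE !eqxx [j == i]eq_sym nij /= !(mulr0, mulr1, add0r) => /sgn_inj ->.
by [].
Qed.

(** The square splits into the diagonal and two triangles exchanged by transposition. *)
Lemma card_ltn_pairs n :
  (#|[set ij : 'I_n * 'I_n | (ij.1 < ij.2)%N]| * 2 + n = n * n)%N.
Proof.
have -> : #|[set ij : 'I_n * 'I_n | (ij.1 < ij.2)%N]| = (\sum_(i < n) \sum_(j < n) (i < j))%N.
  rewrite -sum1dep_card big_mkcond pair_big /=.
  by apply: eq_bigr => ij _; case: ltnP.
rewrite muln2 -addnn {2}exchange_big -big_split /=.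
have diag : n = (\sum_(i < n) \sum_(j < n) (i == j))%N.
  rewrite -[LHS]card_ord -sum1_card; apply: eq_bigr => i _.
  by rewrite (bigD1 i) //= eqxx big1 // => j; rewrite eq_sym => /negPf ->.
rewrite [X in (_ + X)%N]diag -big_split /= -[n in RHS]card_ord -sum_nat_const.
apply: eq_big => // i _.
rewrite -!big_split /= -sum1_card; apply: eq_bigr => j _.
by rewrite -(inj_eq val_inj) /=; case: ltngtP.
Qed.

(** * Dimension, parity checks and low-weight words of the code *)

Section Code.
Variables (m h : nat) (L : fieldExtType F3) (alpha : L).
Hypotheses (m_ge2 : (2 <= m)%N) (h_gt0 : (0 < h)%N) (lt_hm : (h < m)%N).
Hypotheses (dimL : \dim {:L} = m) (prim_a : (3 ^ m - 1)%N.-primitive_root alpha).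
Local Notation e := (3 ^ h - 1)%N.
Local Notation n := (3 ^ m - 1)%N.

Lemma alpha_neq0 : alpha != 0.
Proof.
apply/eqP => a0; have := prim_expr_order prim_a.
have := prim_order_gt0 prim_a; rewrite a0 expr0n.
by case: n => // k _ /esym/eqP; rewrite oner_eq0.
Qed.

(** If [alpha ^+ (3 ^ d) = alpha], then [3 ^ m - 1] divides the positive number [3 ^ d - 1]. *)
Lemma size_minPoly_alpha : size (minPoly 1%VS alpha) = m.+1.
Proof.
apply: size_minPoly1 => // d d_gt0 /eqP; rewrite -{2}[alpha]expr1.
rewrite (eq_prim_root_expr prim_a) eqn_mod_dvd ?expn_gt0 // => /dvdn_leq.
rewrite subn_gt0 -{1}(expn0 3) ltn_exp2l // => /(_ d_gt0) le_md.
rewrite -(leq_exp2l (m := 3)) //; have := expn_gt0 3 d; lia.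
Qed.

(** If the power [3 ^ d] fixes [alpha ^+ e], then [y = alpha ^+ (3 ^ d - 1)] has [y ^+ e = 1] and,
    by coprimality, [y ^+ 2 = 1]. So [3 ^ m - 1] divides [2 (3 ^ d - 1)], which is too small when
    [d < m]. *)
Lemma size_minPoly_alpha_e :
  coprime h m -> size (minPoly 1%VS (alpha ^+ e)) = m.+1.
Proof.
move=> co_hm; apply: size_minPoly1 => // d d_gt0 fix_d.
have Qh : (3 ^ h = e.+1)%N by rewrite subn1 prednK ?expn_gt0.
have Qd : (3 ^ d = (3 ^ d - 1).+1)%N by rewrite subn1 prednK ?expn_gt0.
have a0 := alpha_neq0.
pose y := alpha ^+ (3 ^ d - 1).
have y0 : y != 0 by rewrite expf_neq0.
have yh : y ^+ (3 ^ h) = y.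
  rewrite Qh exprSr -exprM mulnC exprM.
  suff -> : (alpha ^+ e) ^+ (3 ^ d - 1) = 1 by rewrite mul1r.
  by apply: (mulIf (expf_neq0 e a0)); rewrite -exprSr -Qd mul1r.
have y3 : y ^+ 3 = y := expr_coprime_fixed h_gt0 co_hm yh (F3ext_expf y dimL).
have : y ^+ 2 == 1 by apply/eqP/(mulIf y0); rewrite -exprSr y3 mul1r.
rewrite -exprM -(prim_order_dvd prim_a) => /dvdn_leq.
have : (3 ^ 1 <= 3 ^ d)%N by rewrite leq_exp2l.
move=> d3 le_n; rewrite leqNgt; apply/negP => lt_dm.
have : (3 ^ d.+1 <= 3 ^ m)%N by rewrite leq_exp2l.
rewrite expnS; lia.
Qed.

(* Otherwise alpha^e and the m conjugates alpha^(3^i) would be m + 1 distinct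
   roots of a polynomial of degree m. *)
Lemma minPoly_alpha_not_root : ~~ root (minPoly 1%VS alpha) (alpha ^+ e).
Proof.
apply/negP => root_e; have [p def_p] := minPoly_F3P alpha.
have n0 : minPoly 1%VS alpha != 0 by rewrite -size_poly_eq0 size_minPoly.
pose rs := [seq alpha ^+ k | k <- e :: [seq (3 ^ i)%N | i <- iota 0 m]].
suff : (size rs < size (minPoly 1%VS alpha))%N.
  by rewrite size_minPoly_alpha /= !size_map size_iota ltnn.
have Q_gt : (3 ^ h < 3 ^ m)%N by rewrite ltn_exp2l.
have small k : (k < m)%N -> (3 ^ k < n)%N.
  move=> lt_km; have : (3 ^ k.+1 <= 3 ^ m)%N by rewrite leq_exp2l.
  by rewrite expnS; have := expn_gt0 3 k; case: k lt_km => [|k _]; lia.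
apply: max_poly_roots => //.
  rewrite /= root_e /= all_map; apply/allP => k /mapP[i _ ->] /=.
  by rewrite def_p root_F3_Frobenius // -def_p root_minPoly.
rewrite map_inj_in_uniq; last first.
  have bound k : k \in e :: [seq (3 ^ i)%N | i <- iota 0 m] -> (k < n)%N.
    rewrite inE => /orP[/eqP -> | /mapP[i]]; first by have := expn_gt0 3 h; lia.
    by rewrite mem_iota => /andP[_ lt_im] ->; apply: small.
  move=> j k /bound lt_j /bound lt_k /eqP.
  by rewrite (eq_prim_root_expr prim_a) !modn_small // => /eqP.
rewrite /= map_inj_uniq ?iota_uniq ?andbT; last by apply: expnI.
have Qh : (3 <= 3 ^ h)%N by apply: (@leq_pexp2l 3 1).
(* [e] is no power of 3: it is not 1, and otherwise 3 would divide [3 ^ h - e = 1]. *)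
apply/mapP => -[[|i] _ eq_e]; first by rewrite expn0 in eq_e; lia.
have : (3 %| 3 ^ h - e)%N by rewrite dvdn_sub ?dvdn_exp // eq_e dvdn_exp.
by rewrite subKn ?expn_gt0.
Qed.

(** Both polynomials are irreducible over GF(3), so a nontrivial gcd would be associated to both and
    make [alpha ^+ e] a root of the first. *)
Lemma coprime_minPoly :
  coprimep (minPoly 1%VS alpha) (minPoly 1%VS (alpha ^+ e)).
Proof.
set p := minPoly _ _; set r := minPoly _ _.
have gK : gcdp p r \is a polyOver 1%VS.
  have [[p1 def_p] [r1 def_r]] := (minPoly_F3P alpha, minPoly_F3P (alpha ^+ e)).
  by rewrite /p /r def_p def_r -gcdp_map; apply/polyOver1P; exists (gcdp p1 r1).
have [|g1] := orP (minPoly_irr (K := 1%AS) gK (dvdp_gcdl p r)); last first.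
  by rewrite /coprimep size_poly_eq1.
move=> gp; have [gr|g1] := orP (minPoly_irr (K := 1%AS) gK (dvdp_gcdr p r)); last first.
  by rewrite /coprimep size_poly_eq1.
case/negP: minPoly_alpha_not_root; rewrite -/p -(eqp_root gp) (eqp_root gr).
exact: root_minPoly.
Qed.

Lemma card_code :
  coprime h m -> #|cyclic_code_1e n e alpha| = (3 ^ (n - 2 * m))%N.
Proof.
move=> co_hm; have [p def_p] := minPoly_F3P alpha.
have [r def_r] := minPoly_F3P (alpha ^+ e).
have sz_p : size p = m.+1 by rewrite -size_minPoly_alpha def_p size_map_poly.
have sz_r : size r = m.+1 by rewrite -(size_minPoly_alpha_e co_hm) def_r size_map_poly.
have sz_pr : size (p * r) = (2 * m).+1.
  by rewrite size_mul -?size_poly_eq0 ?sz_p ?sz_r // addnS /= mul2n -addnn addSn.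
have le_2m_n : (2 * m <= n)%N.
  (* Induction starting at 2 for [2 * m < 3 ^ m]. *)
  rewrite leq_subRL ?expn_gt0 //; elim: (m) m_ge2 => // k IHk; case: k IHk => // -[|k] // IHk _.
  by rewrite expnS; have := IHk isT; lia.
have := card_dvdp_words sz_pr le_2m_n; rewrite card_Fp // => <-.
apply: eq_card => c; rewrite !inE def_p def_r -rmorphM dvdp_map.
by rewrite word_polyE.
Qed.

Lemma mem_code (c : 'rV[F3]_n) :
  (c \in cyclic_code_1e n e alpha) =
  (syndrome alpha c == 0) && (syndrome (alpha ^+ e) c == 0).
Proof.
rewrite inE Gauss_dvdp ?coprime_minPoly //.
by rewrite !minPoly_dvdp_root /root !horner_word_poly.
Qed.

(** Case analysis on the length of the support, the nonzero terms being distinct powers of [alpha];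
    lengths two and three are [two_terms_neq0] and [three_terms_neq0]. *)
Lemma code_wt_ge4 (c : 'rV[F3]_n) :
  coprime h m -> coprime (3 ^ h - 2) n ->
  c \in cyclic_code_1e n e alpha -> c != 0 -> (4 <= wt c)%N.
Proof.
move=> coA coB; rewrite mem_code !syndrome_support => /andP[/eqP s1 /eqP s2] c_neq0.
have exprC (i : nat) : (alpha ^+ e) ^+ i = (alpha ^+ i) ^+ e by rewrite -!exprM mulnC.
rewrite leqNgt /wt cardE; apply/negP; move: s1 s2.
have supp i : i \in enum [set i | c 0 i != 0] -> c 0 i != 0 by rewrite mem_enum inE.
have x0 (i : nat) : alpha ^+ i != 0 by rewrite expf_neq0 ?alpha_neq0.
have inj_pow (i j : 'I_n) : i != j -> alpha ^+ i != alpha ^+ j.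
  by rewrite (eq_prim_root_expr prim_a) !modn_small.
have := enum_uniq [set i | c 0 i != 0].
case E: (enum _) supp => [|i [|j [|k [|? ?]]]] // supp uniq_S.
- case/eqP: c_neq0; apply/rowP => i; rewrite mxE; apply/eqP.
  by have := mem_enum [set i | c 0 i != 0] i; rewrite E !inE => /esym/negbFE.
- rewrite !big_seq1 => /eqP; rewrite scaler_eq0 (negPf (x0 i)) orbF => ci.
  by rewrite (negPf (supp i _)) ?inE ?eqxx in ci.
- rewrite !big_cons !big_nil !addr0 !exprC => s1 /eqP s2 _; move: s2; apply/negP.
  apply: two_terms_neq0 s1; rewrite ?supp ?inE ?eqxx ?orbT ?x0 // inj_pow //.
  by move: uniq_S; rewrite /= !inE => /andP[].
rewrite !big_cons !big_nil !addr0 !exprC !addrA => s1 /eqP s2 _; move: s2; apply/negP.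
apply: (three_terms_neq0 h_gt0 dimL coA coB) s1; rewrite ?supp ?inE ?eqxx ?orbT ?x0 // inj_pow //.
by move: uniq_S; rewrite /= !inE negb_or => /andP[/andP[]].
Qed.

(** Nonzero elements of [L] are powers of [alpha], so the two equations are the parity checks of a
    word. *)
Lemma exists_code_wt_le3 (a b c : F3) (x y z : L) :
  a != 0 -> b != 0 -> x != 0 -> y != 0 -> z != 0 -> x != y ->
  a *: x + b *: y + c *: z = 0 ->
  a *: x ^+ e + b *: y ^+ e + c *: z ^+ e = 0 ->
  exists w, [/\ w \in cyclic_code_1e n e alpha, w != 0 & (wt w <= 3)%N].
Proof.
move=> a0 b0 x0 y0 z0 neq_xy s1 s2.
have powers (u : L) : u != 0 -> {i : 'I_n | u = alpha ^+ i}.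
  move=> u0; apply: (prim_rootP prim_a); apply: (mulIf u0).
  by rewrite -exprSr subn1 prednK ?expn_gt0 // (F3ext_expf _ dimL) mul1r.
have [[[i xi] [j yj]] [k zk]] := (powers x x0, powers y y0, powers z z0).
have neq_ij : (i == j) = false by apply: contraNF neq_xy => /eqP eq_ij; rewrite xi yj eq_ij.
pose w : 'rV[F3]_n := a *: delta_mx 0 i + b *: delta_mx 0 j + c *: delta_mx 0 k.
exists w; split.
- rewrite mem_code /w !linearD !linearZ /= !syndrome_delta -xi -yj -zk s1 eqxx /=.
  by rewrite -!exprM ![(e * _)%N]mulnC !exprM -xi -yj -zk s2.
(* The position [k] may coincide with [i] or [j]. If [k = i], entry [j] is still [b]; otherwise
   entry [i] is still [a]. *)
- have [eq_ki | neq_ki] := eqVneq k i.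
    apply: contraNneq b0 => /(congr1 (fun u : 'rV[F3]_n => u 0 j)).
    rewrite !mxE !eqxx eq_ki [j == i]eq_sym neq_ij /=.
    by rewrite !mulr0 mulr1 add0r addr0 => ->.
  apply: contraNneq a0 => /(congr1 (fun u : 'rV[F3]_n => u 0 i)).
  rewrite !mxE !eqxx neq_ij [i == k]eq_sym (negPf neq_ki) /=.
  by rewrite !mulr0 mulr1 !addr0 => ->.
apply: leq_trans (wtD _ _) _; apply: (@leq_add _ _ 2 1); last exact: wt_scale_delta.
by apply: leq_trans (wtD _ _) _; apply: (@leq_add _ _ 1 1); apply: wt_scale_delta.
Qed.

(* Pigeonhole: there are 2n(n-1) > (n+1)^2 = |L|^2 words [+-e_i +- e_j] with
   [i < j], so two of them have the same pair of syndromes. *)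
Lemma exists_code_wt_le4 :
  exists w, [/\ w \in cyclic_code_1e n e alpha, w != 0 & (wt w <= 4)%N].
Proof.
(* Coordinate vectors replace elements of [L] to give the count a finite codomain. *)
pose synd (c : 'rV[F3]_n) :=
  (v2r (syndrome alpha c), v2r (syndrome (alpha ^+ e) c)).
pose D : {set ('I_n * 'I_n) * (bool * bool)} :=
  setX [set ij : 'I_n * 'I_n | (ij.1 < ij.2)%N] setT.
(* Gives [n >= 8], large enough for [2n(n-1) > (n+1)^2]. *)
have Q_ge9 : (3 ^ 2 <= 3 ^ m)%N by rewrite leq_exp2l.
have : ~~ dinjectiveb (synd \o @pair_word n) D.
  apply/negP => /dinjectiveP /leq_card_in.
  rewrite card_prod !card_mx card_Fp // !mul1n -dimvf dimL.
  rewrite cardsX cardsT card_prod card_bool leqNgt => /negP; apply.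
  have := card_ltn_pairs n; nia.
case/dinjectivePn => p Dp [r]; rewrite !inE => /andP[neq_rp Dr] [/= eq1 eq2].
exists (pair_word p - pair_word r); split.
- by rewrite mem_code !linearB /= (can_inj v2rK eq1) (can_inj v2rK eq2) !subrr !eqxx.
- rewrite subr_eq0; apply: contraNneq neq_rp => /pair_word_inj -> //.
  by rewrite !inE.
apply: leq_trans (wtB _ _) _.
by apply: (@leq_add _ _ 2 2); apply: wt_pair_word.
Qed.

End Code.

(** * Equivalence of the parameters with the two gcd conditions *)

Theorem theorem8 (m h : nat) (L : fieldExtType F3) (alpha : L) :
  (2 <= m)%N -> (1 <= h <= m - 1)%N ->
  \dim {:L} = m ->
  (3 ^ m - 1)%N.-primitive_root alpha ->
  has_params (cyclic_code_1e (3 ^ m - 1) (3 ^ h - 1) alpha)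
             (3 ^ m - 1 - 2 * m) 4
  <-> (coprime h m /\ coprime (3 ^ h - 2) (3 ^ m - 1)).
Proof.
move=> m_ge2 /andP[h_gt0 le_hm] dimL prim_a.
have m_gt0 : (0 < m)%N by apply: ltnW.
have lt_hm : (h < m)%N by rewrite -(prednK m_gt0) ltnS -subn1.
split=> [[_ _ min_wt] | [coA coB]]; last first.
  have min_wt := code_wt_ge4 m_ge2 h_gt0 lt_hm dimL prim_a coA coB.
  split; [exact: card_code | | by move=> c Cc c0; apply: min_wt].
  have [c [Cc c0 wt_c]] := exists_code_wt_le4 m_ge2 h_gt0 lt_hm dimL prim_a.
  by exists c; rewrite // c0 eqn_leq wt_c min_wt.
have one0 : 1 != 0 :> F3 by [].
have short := exists_code_wt_le3 m_ge2 h_gt0 lt_hm dimL prim_a.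
have no_short w : w \in cyclic_code_1e (3 ^ m - 1) (3 ^ h - 1) alpha -> w != 0 ->
    (wt w <= 3)%N -> False.
  by move=> Cw w0; rewrite leqNgt => /negP; apply; apply: min_wt.
(* If either gcd condition fails, the matching witness [w] gives a nonzero codeword supported on the
   positions of [w], 1 and [w + 1] up to sign, against minimum weight 4. *)
split; apply/negPn/negP => nco.
  have [w [w0 wn1 w1 eq_w]] := exists_same_sign h_gt0 m_gt0 prim_a nco.
  have z0 : - (w + 1) != 0 by rewrite oppr_eq0.
  have [||c [Cc c0 wt_c]] := short 1 1 1 w 1 (- (w + 1)) one0 one0 w0 (oner_neq0 _) z0 w1.
  - by rewrite !scale1r subrr.
  - by rewrite !scale1r expr_predN expr1n.
  exact: no_short wt_c.
have [w [w0 wn1 w1 eq_w]] := exists_mixed_sign h_gt0 m_gt0 prim_a nco.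
have [||c [Cc c0 wt_c]] := short 1 1 (-1) w 1 (w + 1) one0 one0 w0 (oner_neq0 _) wn1 w1.
- by rewrite !scale1r scaleN1r subrr.
- by rewrite !scale1r scaleN1r expr1n eq_w subrr.
exact: no_short wt_c.
Qed.
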